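(* For every integer $i\ge 1$ there is a polynomial $\Psi_i\in\mathbb{Q}[a_1,\dots,a_6][n]$ of degree exactly $i$ in $n$ and divisible by $n$ (i.e. with zero constant term as a polynomial in $n$) such that $\psi_i(n)=\Psi_i(n)$ for every $n\in\mathbb{N}$. In other words, the $i$-th multiplication polynomial $\psi_i$ is a polynomial in $\mathbb{Q}[a_1,\dots,a_6][n]$ of degree $i$ in $n$, and $n\mid\psi_i(n)$.
   Context: Let $a_1,\dots,a_6$ be indeterminates and consider the generic Weierstrass curve $y^2z+a_1xyz+a_3yz^2=x^3+a_2x^2z+a_4xz^2+a_6z^3$ with its usual group law (identity $\mathcal{O}=(0:1:0)$). For an integer $K\ge 2$ let $A_K=\mathbb{Z}[a_1,\dots,a_6][X]/(X^K)$. There is a unique $F(X)\in X^3A_K$ satisfying $F=X^3-a_1XF+a_2X^2F-a_3F^2+a_4XF^2+a_6F^3$ (obtained by iterated substitution), so that $P=(X:1:F(X))$ is a point of the curve over $A_K$ lying above $\mathcal{O}$. For $n\in\mathbb{N}$, computing $nP$ with the group law and normalizing its $y$-coordinate to $1$ (possible since it is a unit of $A_K$), its $x$-coordinate has the form $(nP)_x=\sum_{i=1}^{K-1}\psi_i(n)X^i$ with uniquely determined $\psi_i(n)\in\mathbb{Z}[a_1,\dots,a_6]$, independent of $K$ as long as $K\ge i+1$. The function $n\mapsto\psi_i(n)$ is called the $i$-th multiplication polynomial. (For an elliptic curve $E$ with these coefficients over a finite local ring $R$ with maximal ideal $\mathfrak m$, every point $P$ of $E$ reducing to $\mathcal O$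 modulo $\mathfrak m$ has a unique form $(P_x:1:P_z)$ with $P_x,P_z\in\mathfrak m$, and $(nP)_x=\sum_i\psi_i(n)P_x^i$ with $\psi_i(n)$ evaluated at the curve coefficients.) *)

(* Defs.v *)
From mathcomp Require Import all_boot all_order all_algebra.
From mathcomp Require Import mpoly ring.

Set Implicit Arguments.
Unset Strict Implicit.
Unset Printing Implicit Defensive.

Import GRing.Theory.
Local Open Scope ring_scope.

(* Every point lying above O = (0:1:0) has a unit as its y-coordinate, so it  *)
(* is represented by the pair (x, z) such that the point is (x:1:z); O itself *)
(* is (0, 0).                                                                 *)

Definition weierstrass (R : comNzRingType) (a1 a2 a3 a4 a6 x z : R) : R :=
  x ^+ 3 + a2 * x ^+ 2 * z + a4 * x * z ^+ 2 + a6 * z ^+ 3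
  - (z + a1 * x * z + a3 * z ^+ 2).

Section ChordTangent.
Context {R : comNzRingType}.
Implicit Types (x : R) (P Q S : R * R).

(* The line z = l x + v cuts the curve exactly in P, Q and S, counted with    *)
(* multiplicity. This makes sense over any ring, and covers tangents.         *)
Definition collinear (a1 a2 a3 a4 a6 : R) P Q S : Prop :=
  exists l v c : R,
    [/\ P.2 = l * P.1 + v, Q.2 = l * Q.1 + v, S.2 = l * S.1 + v &
        weierstrass a1%:P a2%:P a3%:P a4%:P a6%:P 'X (l%:P * 'X + v%:P)
        = c%:P * (('X - P.1%:P) * ('X - Q.1%:P) * ('X - S.1%:P))].

(* The inverse of u as soon as (1 - u) ^+ K = 0: a geometric sum. *)
Definition unip_inv (K : nat) (u : R) : R := \sum_(j < K) (1 - u) ^+ j.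

(* The slope (z1 - z2) / (x1 - x2) of the chord, in a form that also covers   *)
(* the cases where x1 - x2 is not invertible: subtracting the equations of    *)
(* the curve at P and Q gives                                                 *)
(*   (z1 - z2) * slope_den = (x1 - x2) * slope_num.                           *)
Definition slope_num (a1 a2 a4 : R) P Q : R :=
  P.1 ^+ 2 + P.1 * Q.1 + Q.1 ^+ 2 + a2 * (P.1 + Q.1) * P.2
  + a4 * P.2 ^+ 2 - a1 * P.2.

Definition slope_den (a1 a2 a3 a4 a6 : R) P Q : R :=
  1 + a1 * Q.1 + a3 * (P.2 + Q.2) - a2 * Q.1 ^+ 2
  - a4 * Q.1 * (P.2 + Q.2) - a6 * (P.2 ^+ 2 + P.2 * Q.2 + Q.2 ^+ 2).

(* The third point of intersection of the curve with the chord through P and  *)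
(* Q (the tangent at P if P = Q), from the sum of the roots of the cubic in x *)
(* obtained by substituting z = l x + v in the equation.                      *)
Definition third K (a1 a2 a3 a4 a6 : R) P Q : R * R :=
  let l := slope_num a1 a2 a4 P Q
           * unip_inv K (slope_den a1 a2 a3 a4 a6 P Q) in
  let v := P.2 - l * P.1 in
  let c3 := 1 + a2 * l + a4 * l ^+ 2 + a6 * l ^+ 3 in
  let c2 := a2 * v + a4 * l * v *+ 2 + a6 * l ^+ 2 * v *+ 3
            - a1 * l - a3 * l ^+ 2 in
  let x := - (c2 * unip_inv K c3) - P.1 - Q.1 in
  (x, l * x + v).

(* - (x:y:z) = (x : - y - a1 x - a3 z : z), normalized to y = 1. *)
Definition opp_pt K (a1 a3 : R) P : R * R :=
  let u := unip_inv K (1 + a1 * P.1 + a3 * P.2) in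
  (- (P.1 * u), - (P.2 * u)).

Definition add_pt K (a1 a2 a3 a4 a6 : R) P Q : R * R :=
  opp_pt K a1 a3 (third K a1 a2 a3 a4 a6 P Q).

Definition mul_pt K (a1 a2 a3 a4 a6 : R) n P : R * R :=
  iter n (add_pt K a1 a2 a3 a4 a6 P) (0, 0).

Definition solve_step (a1 a2 a3 a4 a6 : R) x z : R :=
  x ^+ 3 - a1 * x * z + a2 * x ^+ 2 * z - a3 * z ^+ 2
  + a4 * x * z ^+ 2 + a6 * z ^+ 3.

(* Iterated substitution from 0: each round gains at least one order in x. *)
Definition solve_z K (a1 a2 a3 a4 a6 : R) x : R :=
  iter K (solve_step a1 a2 a3 a4 a6 x) 0.

Lemma weierstrass_line (a1 a2 a3 a4 a6 l v : R) :
  weierstrass a1%:P a2%:P a3%:P a4%:P a6%:P 'X (l%:P * 'X + v%:P) =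
  (1 + a2 * l + a4 * l ^+ 2 + a6 * l ^+ 3)%:P * 'X^3
  + (a2 * v + a4 * l * v *+ 2 + a6 * l ^+ 2 * v *+ 3
     - a1 * l - a3 * l ^+ 2)%:P * 'X^2
  + (a4 * v ^+ 2 + a6 * l * v ^+ 2 *+ 3 - l - a1 * v - a3 * l * v *+ 2)%:P * 'X
  + (a6 * v ^+ 3 - v - a3 * v ^+ 2)%:P.
Proof.
rewrite /weierstrass !(polyCD, polyCN, polyCM, polyCMn, polyC_exp, polyC1).
ring.
Qed.

Lemma collinear_on_curve (a1 a2 a3 a4 a6 : R) P Q S :
  collinear a1 a2 a3 a4 a6 P Q S -> weierstrass a1 a2 a3 a4 a6 S.1 S.2 = 0.
Proof.
move=> [l [v [c [_ _ -> E]]]].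
move/(congr1 (fun p : {poly R} => p.[S.1])): E.
rewrite weierstrass_line !(hornerD, hornerN, hornerM, hornerXn, hornerX, hornerC).
by rewrite subrr !mulr0 => <-; rewrite /weierstrass; ring.
Qed.

Lemma cubic_roots (c x1 x2 x3 : R) :
  let c2 := - c * (x1 + x2 + x3) in
  let c1 := - (c * (x1 ^+ 2 + x1 * x2 + x2 ^+ 2) + c2 * (x1 + x2)) in
  c%:P * 'X^3 + c2%:P * 'X^2 + c1%:P * 'X
  + (- (c * x1 ^+ 3 + c2 * x1 ^+ 2 + c1 * x1))%:P
  = c%:P * (('X - x1%:P) * ('X - x2%:P) * ('X - x3%:P)).
Proof. by rewrite /= !(polyCD, polyCN, polyCM, polyC_exp); ring. Qed.

Lemma collinear_third K (a1 a2 a3 a4 a6 : R) P Q :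
  let D := slope_den a1 a2 a3 a4 a6 P Q in
  let l := slope_num a1 a2 a4 P Q * unip_inv K D in
  let C := 1 + a2 * l + a4 * l ^+ 2 + a6 * l ^+ 3 in
  D * unip_inv K D = 1 -> C * unip_inv K C = 1 ->
  (P.1 - Q.1) * slope_num a1 a2 a4 P Q = (P.2 - Q.2) * D ->
  weierstrass a1 a2 a3 a4 a6 P.1 P.2 = 0 ->
  collinear a1 a2 a3 a4 a6 P Q (third K a1 a2 a3 a4 a6 P Q).
Proof.
move=> D l C HD HC Hs HP.
have Hl : l * D = slope_num a1 a2 a4 P Q.
  by rewrite /l -mulrA (mulrC (unip_inv _ _)) HD mulr1.
have HQ : Q.2 = l * Q.1 + (P.2 - l * P.1).
  have : (P.2 - Q.2) * D * unip_inv K D = l * (P.1 - Q.1).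
    by rewrite -Hs /l; ring.
  rewrite -mulrA HD mulr1 => H.
  have -> : Q.2 = P.2 - (P.2 - Q.2) by ring.
  by rewrite H; ring.
exists l, (P.2 - l * P.1), C; split=> //; first by ring.
rewrite weierstrass_line /third -/D -/l /= -/C.
set v := P.2 - _ in HQ *.
set q2 := _ - a3 * l ^+ 2.
set q1 := (X in X%:P * 'X).
set q0 := (X in _ + X%:P).
set x3 := - (_ * _) - _ - _.
have Hv : P.2 = l * P.1 + v by rewrite /v; ring.
have E2 : q2 = - C * (P.1 + Q.1 + x3).
  transitivity (C * unip_inv K C * q2); first by rewrite HC mul1r.
  by rewrite /x3; ring.
have E1 : C * (P.1 ^+ 2 + P.1 * Q.1 + Q.1 ^+ 2) + q2 * (P.1 + Q.1) + q1 = 0.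
  transitivity (slope_num a1 a2 a4 P Q - l * D); last by rewrite Hl subrr.
  by rewrite /C /q2 /q1 /D /slope_num /slope_den HQ Hv; ring.
have E0 : C * P.1 ^+ 3 + q2 * P.1 ^+ 2 + q1 * P.1 + q0 = 0.
  by rewrite -HP /weierstrass /C /q2 /q1 /q0 Hv; ring.
have F1 : q1 = - (C * (P.1 ^+ 2 + P.1 * Q.1 + Q.1 ^+ 2) + q2 * (P.1 + Q.1)).
  by apply/eqP; rewrite -addr_eq0 addrC E1.
have F0 : q0 = - (C * P.1 ^+ 3 + q2 * P.1 ^+ 2 + q1 * P.1).
  by apply/eqP; rewrite -addr_eq0 addrC E0.
by rewrite F0 F1 E2 cubic_roots.
Qed.

Lemma third_unique K (a1 a2 a3 a4 a6 : R) P Q S :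
  let D := slope_den a1 a2 a3 a4 a6 P Q in
  let l := slope_num a1 a2 a4 P Q * unip_inv K D in
  let C := 1 + a2 * l + a4 * l ^+ 2 + a6 * l ^+ 3 in
  D * unip_inv K D = 1 -> C * unip_inv K C = 1 ->
  collinear a1 a2 a3 a4 a6 P Q S -> S = third K a1 a2 a3 a4 a6 P Q.
Proof.
move=> D l C HD HC [m [v [c [HP HQ HS]]]].
rewrite weierstrass_line.
set q3 := (X in X%:P * 'X^3).
set q2 := (X in X%:P * 'X^2).
set q1 := (X in X%:P * 'X).
set q0 := (X in _ + X%:P).
rewrite -cubic_roots.
set e1 := - (_ + _ * (_ + _)); set e0 := - (_ + _ * P.1).
move=> H; have cf k : (q3%:P * 'X^3 + q2%:P * 'X^2 + q1%:P * 'X + q0%:P)`_k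
  = (c%:P * 'X^3 + (- c * (P.1 + Q.1 + S.1))%:P * 'X^2 + e1%:P * 'X + e0%:P)`_k.
  by rewrite H.
move: {H} (cf 3%N) (cf 2%N) (cf 1%N).
rewrite !coefD !coefCM !coefXn !coefX !coefC /=.
rewrite !(mulr0, mulr1, addr0, add0r) => E3 E2 E1.
have Hm : m * D = slope_num a1 a2 a4 P Q.
  apply/esym/eqP; rewrite -subr_eq0; apply/eqP.
  transitivity (q3 * (P.1 ^+ 2 + P.1 * Q.1 + Q.1 ^+ 2) + q2 * (P.1 + Q.1) + q1).
    by rewrite /q3 /q2 /q1 /D /slope_num /slope_den HQ HP; ring.
  by rewrite E3 E2 E1 /e1; ring.
have {}Hm : m = l by rewrite /l -Hm -mulrA HD mulr1.
have Hv : v = P.2 - l * P.1 by rewrite HP Hm; ring.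
have Hx : S.1 = - (q2 * unip_inv K C) - P.1 - Q.1.
  have -> : q2 * unip_inv K C = - (C * unip_inv K C) * (P.1 + Q.1 + S.1).
    by rewrite E2 -E3 /q3 Hm /C; ring.
  by rewrite HC; ring.
rewrite [S]surjective_pairing HS Hx /third -/D -/l /= -/C -Hv.
by rewrite /q2 Hm.
Qed.

End ChordTangent.

Section Truncated.
Context {B : comNzRingType}.

Definition trunc (K : nat) : comNzRingType := {poly %/ ('X^K : {poly B})}.

Definition truncC K (b : B) : trunc K := qpolyC 'X^K b.
Definition truncX K : trunc K := qpolyX 'X^K.

Definition generic_point K (b1 b2 b3 b4 b6 : B) : trunc K * trunc K :=
  let c := @truncC K in
  (truncX K, solve_z K (c b1) (c b2) (c b3) (c b4) (c b6) (truncX K)).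

Definition mul_generic K (b1 b2 b3 b4 b6 : B) n : trunc K * trunc K :=
  let c := @truncC K in
  mul_pt K (c b1) (c b2) (c b3) (c b4) (c b6) n
    (generic_point K b1 b2 b3 b4 b6).

(* The points of the curve over B[X]/(X^K) that reduce to O modulo X. *)
Definition above_O K (b1 b2 b3 b4 b6 : B) (P : trunc K * trunc K) : Prop :=
  let c := @truncC K in
  [/\ (P.1 : {poly B})`_0 = 0, (P.2 : {poly B})`_0 = 0 &
      weierstrass (c b1) (c b2) (c b3) (c b4) (c b6) P.1 P.2 = 0].

Section Theory.
Context (n : nat) (b1 b2 b3 b4 b6 : B).
Local Notation K := n.+1.
Local Notation A := (trunc K).
Local Notation qX := (truncX K).
Local Notation a1 := (truncC K b1).
Local Notation a2 := (truncC K b2).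
Local Notation a3 := (truncC K b3).
Local Notation a4 := (truncC K b4).
Local Notation a6 := (truncC K b6).
Local Notation onO := (@above_O K b1 b2 b3 b4 b6).
Local Notation O := (0 : A, 0 : A).
Implicit Types (p q x z : A) (P Q S : A * A).

Lemma size_trunc p : (size (p : {poly B}) <= K)%N.
Proof.
have E : (size (mk_monic ('X^K : {poly B}))).-1 = K.
  by rewrite mk_monic_Xn size_polyXn.
by apply: leq_trans (size_npoly p) _; rewrite -[X in (_ <= X)%N]E.
Qed.

Lemma coef_truncM p q i : (i < K)%N ->
  ((p * q : A) : {poly B})`_i = ((p : {poly B}) * q)`_i.
Proof.
move=> iK; have -> : (p * q : A) = take_poly K ((p : {poly B}) * q) :> {poly B}.
  rewrite Pdiv.RingMonic.take_poly_rmodp.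
  exact: (congr1 (Pdiv.CommonRing.rmodp _) (mk_monic_Xn B K)).
by rewrite coef_take_poly iK.
Qed.

Definition c0 (p : A) : B := (p : {poly B})`_0.

Lemma c0D p q : c0 (p + q) = c0 p + c0 q. Proof. exact: coefD. Qed.
Lemma c0N p : c0 (- p) = - c0 p. Proof. exact: coefN. Qed.
Lemma c00 : c0 0 = 0. Proof. exact: coef0. Qed.
Lemma c01 : c0 1 = 1. Proof. by rewrite /c0 /= coefC. Qed.
Lemma c0M p q : c0 (p * q) = c0 p * c0 q.
Proof. by rewrite /c0 coef_truncM // coefM big_ord1. Qed.
Lemma c0X p k : c0 (p ^+ k) = c0 p ^+ k.
Proof. by elim: k => [|k IH]; rewrite ?c01 // !exprS c0M IH. Qed.
Lemma c0Mn p k : c0 (p *+ k) = c0 p *+ k.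
Proof. by elim: k => [|k IH]; rewrite ?c00 // !mulrS c0D IH. Qed.
Lemma c0qX : c0 qX = 0.
Proof.
transitivity ((take_poly K 'X : {poly B})`_0); last first.
  by rewrite coef_take_poly coefX.
congr (_`_0); congr polyseq; rewrite Pdiv.RingMonic.take_poly_rmodp.
exact: (congr1 (Pdiv.CommonRing.rmodp _) (mk_monic_Xn B K)).
Qed.

Definition c0E := (c0D, c0N, c0M, c0X, c0Mn, c00, c01).

Definition ord k p := forall i, (i < k)%N -> (p : {poly B})`_i = 0.

Lemma ordSM k p q : ord k p -> c0 q = 0 -> ord k.+1 (p * q).
Proof.
move=> Hp Hq i ik; have [iK|Ki] := ltnP i K; last first.
  rewrite nth_default // (leq_trans _ Ki) //.
  exact: size_trunc.
rewrite coef_truncM // coefM big1 // => j _.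
have [jk|kj] := ltnP j k; first by rewrite Hp // mul0r.
have -> : (i - j = 0)%N by apply/eqP; rewrite subn_eq0 (leq_trans _ kj).
by rewrite [_`_0]Hq mulr0.
Qed.

Lemma ord_eq0 p : ord K p -> p = 0.
Proof.
move=> H; apply: val_inj; apply/polyP => i /=; rewrite coef0.
have [/H//|Ki] := ltnP i K; rewrite nth_default // (leq_trans _ Ki) //.
exact: size_trunc.
Qed.

Lemma c0_nilp p : c0 p = 0 -> p ^+ K = 0.
Proof.
move=> Hp; apply: ord_eq0; suff: forall k, ord k (p ^+ k) by apply.
elim=> [|k IH] //.
by rewrite exprSr; apply: ordSM.
Qed.

Lemma unip_invP (u : A) : c0 u = 1 -> u * unip_inv K u = 1.
Proof.
move=> Hu; have : c0 (1 - u) = 0 by rewrite !c0E Hu subrr.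
move/c0_nilp=> H; have := subrX1 (1 - u) K; rewrite H sub0r => /eqP.
rewrite eq_sym -eqr_oppLR -mulNr => /eqP <-; congr (_ * _); ring.
Qed.

Local Notation step := (solve_step a1 a2 a3 a4 a6 qX).

Definition stepd z z' : A :=
  - (a1 * qX) + a2 * qX ^+ 2 - a3 * (z + z') + a4 * qX * (z + z')
  + a6 * (z ^+ 2 + z * z' + z' ^+ 2).

Lemma step_sub z z' : step z - step z' = (z - z') * stepd z z'.
Proof. by rewrite /solve_step /stepd; ring. Qed.

Lemma c0_stepd z z' : c0 z = 0 -> c0 z' = 0 -> c0 (stepd z z') = 0.
Proof. by move=> H H'; rewrite /stepd !c0E H H' c0qX; ring. Qed.

Local Notation F := (solve_z K a1 a2 a3 a4 a6 qX).

Lemma solve_z_X3 : exists G : A, F = qX ^+ 3 * G.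
Proof.
rewrite /solve_z; suff: forall k, exists G, iter k step 0 = qX ^+ 3 * G by apply.
elim=> [|k [G IH]] /=; first by exists 0; rewrite mulr0.
rewrite {}IH /solve_step; exists (1 - a1 * qX * G + a2 * qX ^+ 2 * G - a3 * qX ^+ 3 * G ^+ 2
                   + a4 * qX ^+ 4 * G ^+ 2 + a6 * qX ^+ 6 * G ^+ 3).
ring.
Qed.

Lemma solve_zP : F = step F.
Proof.
rewrite /solve_z; set f := step.
suff H k : ord k (iter k.+1 f 0 - iter k f 0) /\ c0 (iter k f 0) = 0.
  by apply/esym/eqP; rewrite -subr_eq0; apply/eqP/ord_eq0; case: (H K).
have c0f z : c0 z = 0 -> c0 (f z) = 0.
  by move=> Hz; rewrite /f /solve_step !c0E Hz c0qX; ring.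
elim: k => [|k [IH Hc]]; first by split=> //; rewrite /= c00.
split; last by rewrite iterS; apply: c0f.
rewrite [X in X - _]iterS [X in _ - X]iterS step_sub.
by apply: ordSM => //; apply: c0_stepd; rewrite // iterS; apply: c0f.
Qed.

Lemma solve_z_unique (z G : A) : z = qX ^+ 3 * G -> z = step z -> z = F.
Proof.
have c0z y H : y = qX ^+ 3 * H -> c0 y = 0.
  by move=> ->; rewrite !c0E c0qX expr0n mul0r.
move=> /c0z Hz zE; have [H /c0z HF] := solve_z_X3.
have E : z - F = (z - F) * stepd z F by rewrite -step_sub -zE -solve_zP.
apply/eqP; rewrite -subr_eq0; apply/eqP.
have H' k : z - F = (z - F) * stepd z F ^+ k.
  by elim: k => [|k IH]; rewrite ?mulr1 // exprS mulrA -E.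
by rewrite (H' K) (c0_nilp (c0_stepd Hz HF)) mulr0.
Qed.

Lemma above_OE P : onO P ->
  [/\ c0 P.1 = 0, c0 P.2 = 0 & weierstrass a1 a2 a3 a4 a6 P.1 P.2 = 0].
Proof. by []. Qed.

Lemma generic_above_O : onO (generic_point K b1 b2 b3 b4 b6).
Proof.
have [G FG] := solve_z_X3; have zE := solve_zP.
split; first exact: c0qX.
  by change (c0 F = 0); rewrite FG !c0E c0qX expr0n mul0r.
change (weierstrass a1 a2 a3 a4 a6 qX F = 0).
transitivity (step F - F); last by rewrite -zE subrr.
by rewrite /weierstrass /solve_step; ring.
Qed.

Section Chord.
Context (P Q : A * A) (HP : onO P) (HQ : onO Q).
Local Notation D := (slope_den a1 a2 a3 a4 a6 P Q).
Local Notation l := (slope_num a1 a2 a4 P Q * unip_inv K D).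
Local Notation C := (1 + a2 * l + a4 * l ^+ 2 + a6 * l ^+ 3).

Lemma slope_denV : D * unip_inv K D = 1.
Proof.
have [p1 p2 _] := above_OE HP; have [q1 q2 _] := above_OE HQ; apply: unip_invP.
by rewrite /slope_den !c0E ?(p1, p2, q1, q2); ring.
Qed.

Lemma c0_slope : c0 l = 0.
Proof.
have [p1 p2 _] := above_OE HP; have [q1 q2 _] := above_OE HQ.
by rewrite c0M /slope_num !c0E ?(p1, p2, q1); ring.
Qed.

Lemma lead_coefV : C * unip_inv K C = 1.
Proof. by apply: unip_invP; rewrite !(c0D, c0M a2, c0M a4, c0M a6, c0X) c0_slope c01; ring. Qed.

Lemma third_collinear :
  collinear a1 a2 a3 a4 a6 P Q (third K a1 a2 a3 a4 a6 P Q).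
Proof.
case: HP HQ => [_ _ wP] [_ _ wQ].
apply: collinear_third => //; [exact: slope_denV | exact: lead_coefV |].
apply/eqP; rewrite -subr_eq0; apply/eqP.
transitivity (weierstrass a1 a2 a3 a4 a6 P.1 P.2
              - weierstrass a1 a2 a3 a4 a6 Q.1 Q.2).
  by rewrite /weierstrass /slope_num /slope_den; ring.
by rewrite wP wQ subrr.
Qed.

Lemma collinear_unique S :
  collinear a1 a2 a3 a4 a6 P Q S -> S = third K a1 a2 a3 a4 a6 P Q.
Proof. by apply: third_unique; [exact: slope_denV | exact: lead_coefV]. Qed.

End Chord.

Lemma third_above_O P Q : onO P -> onO Q -> onO (third K a1 a2 a3 a4 a6 P Q).
Proof.
move=> HP HQ; have cl := c0_slope HP HQ.
have [p1 p2 _] := above_OE HP; have [q1 q2 _] := above_OE HQ.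
have cx : c0 (third K a1 a2 a3 a4 a6 P Q).1 = 0.
  rewrite /third /=; move: (slope_num _ _ _ _ _ * unip_inv _ (slope_den _ _ _ _ _ _ _)) cl
    => l cl.
  by rewrite !c0E cl ?(p1, p2, q1); ring.
split; first exact: cx.
  change (c0 (third K a1 a2 a3 a4 a6 P Q).2 = 0); rewrite /third /=.
  move: (slope_num _ _ _ _ _ * unip_inv _ (slope_den _ _ _ _ _ _ _)) cl
    => l cl.
  by rewrite c0D (c0M l) cl c0D c0N (c0M l) cl p2; ring.
by apply: collinear_on_curve (third_collinear HP HQ).
Qed.

Lemma c0_opp_den P : onO P -> c0 (1 + a1 * P.1 + a3 * P.2) = 1.
Proof. by move=> /above_OE [p1 p2 _]; rewrite !c0E ?(p1, p2); ring. Qed.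

Lemma opp_above_O P : onO P -> onO (opp_pt K a1 a3 P).
Proof.
move=> HP; have := unip_invP (c0_opp_den HP).
have [p1 p2 wP] := above_OE HP; rewrite /opp_pt; set u := unip_inv _ _ => uE.
split.
- by change (c0 (- (P.1 * u)) = 0); rewrite c0N c0M p1 mul0r oppr0.
- by change (c0 (- (P.2 * u)) = 0); rewrite c0N c0M p2 mul0r oppr0.
change (weierstrass a1 a2 a3 a4 a6 (- (P.1 * u)) (- (P.2 * u)) = 0).
transitivity (- u ^+ 3 * weierstrass a1 a2 a3 a4 a6 P.1 P.2
  + P.2 * u * (1 - ((1 + a1 * P.1 + a3 * P.2) * u))
    * (1 + u)); last by rewrite uE wP; ring.
by rewrite /weierstrass; ring.
Qed.

Lemma O_above_O : onO O.
Proof.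
split; [exact: c00 | exact: c00 |].
by change (weierstrass a1 a2 a3 a4 a6 (0 : A) 0 = 0); rewrite /weierstrass; ring.
Qed.

Lemma opp_collinear P : onO P -> collinear a1 a2 a3 a4 a6 P (opp_pt K a1 a3 P) O.
Proof.
move=> HP; have uE := unip_invP (c0_opp_den HP).
have [p1 p2 wP] := above_OE HP.
have := slope_denV O_above_O HP; rewrite /slope_den /=.
set u := unip_inv K (_ + a3 * P.2) in uE *.
set w := unip_inv K _; set D := (X in X * w = 1) => DE.
pose l := P.1 ^+ 2 * w; pose c := 1 + a2 * l + a4 * l ^+ 2 + a6 * l ^+ 3.
have HD : P.2 * D = P.1 ^+ 3.
  transitivity (P.1 ^+ 3 - weierstrass a1 a2 a3 a4 a6 P.1 P.2).
    by rewrite /D /weierstrass; ring.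
  by rewrite wP subr0.
have Pz : P.2 = l * P.1.
  transitivity (P.2 * D * w); first by rewrite -mulrA DE mulr1.
  by rewrite HD /l; ring.
have lD : l * D = P.1 ^+ 2.
  by rewrite /l -mulrA [w * D]mulrC DE mulr1.
have ls : l * (1 + a1 * P.1 + a3 * P.2) = c * P.1 ^+ 2.
  transitivity (l * D + (c - 1) * P.1 ^+ 2); last by rewrite lD; ring.
  by rewrite /D /c Pz; ring.
have lE : l = c * P.1 ^+ 2 * u.
  by rewrite -ls -mulrA uE mulr1.
have c2E : - a1 * l - a3 * l ^+ 2 = c * (P.1 * u - P.1).
  transitivity (- (c * P.1 ^+ 2 * u) * (a1 + a3 * l)); first by rewrite -lE; ring.
  transitivity (c * (P.1 * u - P.1 * ((1 + a1 * P.1 + a3 * P.2) * u))).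
    by rewrite Pz; ring.
  by rewrite uE mulr1.
exists l, 0, c; split; first by rewrite addr0.
- by rewrite /opp_pt -/u /= [in LHS]Pz; ring.
- by rewrite addr0 mulr0.
rewrite [(opp_pt _ _ _ _).1](_ : _ = - (P.1 * u)) // [O.1](_ : _ = 0) //.
rewrite weierstrass_line -/c.
rewrite (_ : _ - a3 * l ^+ 2 = c * (P.1 * u - P.1)); last by rewrite -c2E; ring.
rewrite (_ : _ - a3 * l * 0 *+ 2 = - (c * P.1 ^+ 2 * u)); last by rewrite -lE; ring.
rewrite (_ : a6 * 0 ^+ 3 - 0 - _ = 0); last by ring.
move: (c) (P.1) (u) => c' x' u'; clear.
by rewrite !(polyCD, polyCN, polyCM, polyC_exp); ring.
Qed.

Lemma add_above_O P Q : onO P -> onO Q -> onO (add_pt K a1 a2 a3 a4 a6 P Q).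
Proof. by move=> HP HQ; apply/opp_above_O/third_above_O. Qed.

Lemma mul_above_O k P : onO P -> onO (mul_pt K a1 a2 a3 a4 a6 k P).
Proof.
move=> HP; elim: k => [|k IH]; first exact: O_above_O.
exact: add_above_O.
Qed.

End Theory.

(* The coefficient of X^i in the x-coordinate of n P, over B[X]/(X^K). *)
Definition mul_coef K (b1 b2 b3 b4 b6 : B) n i : B :=
  ((mul_generic K b1 b2 b3 b4 b6 n).1 : {poly B})`_i.

Lemma mul_coefE K (b1 b2 b3 b4 b6 : B) n : (0 < K)%N ->
  (mul_generic K b1 b2 b3 b4 b6 n).1
  = \sum_(1 <= i < K) truncC K (mul_coef K b1 b2 b3 b4 b6 n i) * truncX K ^+ i.
Proof.
case: K => // m _; set P := mul_generic _ _ _ _ _ _ _.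
have [c1 _ _] : above_O b1 b2 b3 b4 b6 P.
  exact/mul_above_O/generic_above_O.
have inK (p : trunc m.+1) : in_qpoly 'X^(m.+1) (p : {poly B}) = p.
  by apply/val_inj/in_qpoly_small/size_mk_monic.
have inC (b : B) : in_qpoly 'X^(m.+1) b%:P = truncC m.+1 b.
  exact: (inK (truncC m.+1 b)).
have szP : (size (P.1 : {poly B}) <= m.+1)%N := size_trunc P.1.
rewrite -[LHS]inK.
rewrite [X in in_qpoly _ X](_ : _ = \sum_(i < m.+1) ((P.1 : {poly B})`_i)%:P * 'X^i).
  rewrite rmorph_sum big_ord_recl c1 mul0r rmorph0 add0r big_add1 big_mkord.
  by apply: eq_bigr => i _; rewrite rmorphM rmorphXn -inC.
apply/polyP => i; rewrite coef_sum.
under eq_bigr do rewrite coefCM coefXn.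
have [im|mi] := ltnP i m.+1.
  rewrite (bigD1 (Ordinal im)) //= eqxx mulr1 big1 ?addr0 // => j.
  by rewrite -val_eqE eq_sym => /negPf /= ->; rewrite mulr0.
rewrite nth_default ?(leq_trans szP) // big1 // => j _.
by rewrite (_ : i == j = false) ?mulr0 // gtn_eqF // (leq_trans _ mi).
Qed.

End Truncated.

(* The coefficient ring Z[a1, a2, a3, a4, a6]; there is no a5. *)
Definition Zcoef : comNzRingType := {mpoly int[5]}.

Definition multiplication_polynomial K i n : {mpoly int[5]} :=
  mul_coef K ('X_(inord 0) : Zcoef) 'X_(inord 1) 'X_(inord 2) 'X_(inord 3)
    'X_(inord 4) n i.

(* Main.v *)
From HB Require Import structures.
Require Import Defs.
From mathcomp Require Import all_boot all_order all_algebra.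
From mathcomp Require Import mpoly ring.

(* Adding P = (X : 1 : F) to a point Q changes its coordinates by a multiple  *)
(* of X, since at X = 0 the point P is the identity. Grade sequences of       *)
(* truncated power series by asking that the coefficient of X^i be a          *)
(* polynomial in n of degree at most i: these sequences form a ring, hence    *)
(* the X-quotient of (n+1)P - nP is graded up to order k as soon as nP is.    *)
(* The difference of the i-th coefficients of (n+1)P and nP is then a         *)
(* polynomial of degree at most i - 1, and summing over n raises the degree   *)
(* by one. The degree is exactly i because on the nodal cubic                 *)
(* z + x z = x^3 the group law is 1 + x(P + Q) = (1 + x(P)) (1 + x(Q)), so    *)
(* psi_i specializes to n |-> 'C(n, i).                                       *)

Set Implicit Arguments.
Unset Strict Implicit.

Import GRing.Theory.
Local Open Scope ring_scope.

(** The degree bound is a bootstrap on the order in X. The formulas for the sum preserve congruence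
    modulo X with a graded quotient ([congX_third], [congX_opp_pt]). Since P is congruent to O, P +
    nP is congruent to O + nP = nP ([congX_add_pt], [add_O_pt]). Multiplication by X shifts
    coefficients up by one, so degree bounds for the coefficients of nP below k bound the
    n-difference of the coefficient at k, and summing over n bounds that coefficient
    ([filtered_step], [polyfun_antidifference]). The sum involves both coordinates, so
    [filtered_mul_generic] runs the induction on x and z together.

    By [mul_coef_map], psi_i is independent of the precision K and compatible with ring morphisms.
    This serves twice: to pass from integers to rationals, where summation over n may divide, and to
    specialize to the nodal cubic. There [mul_coef_nodal] and [size_binomial_poly] show that the
    degree i is attained. Divisibility by n is the vanishing at n = 0, where nP = O. *)

Lemma unip_inv_widen (R : comNzRingType) (K K' : nat) (u : R) :
  (K' <= K)%N -> u * unip_inv K' u = 1 -> unip_inv K u = unip_inv K' u.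
Proof.
move=> leK uV.
(* The geometric sum gives (1 - u)^K' = 1 - u * [unip_inv K' u], so every term from K' on
   vanishes. *)
have uK' : (1 - u) ^+ K' = 0.
  rewrite -[LHS](subrK 1) subrX1 -/(unip_inv K' u).
  by rewrite (_ : 1 - u - 1 = - u) ?mulNr ?uV ?addNr //; ring.
rewrite /unip_inv -(subnK leK) addnC big_split_ord /=.
rewrite [X in _ + X]big1 ?addr0 //.
by move=> j _; rewrite exprD uK' mul0r.
Qed.

Lemma mul_ptS (R : comNzRingType) K (a1 a2 a3 a4 a6 : R) n P :
  mul_pt K a1 a2 a3 a4 a6 n.+1 P =
  add_pt K a1 a2 a3 a4 a6 P (mul_pt K a1 a2 a3 a4 a6 n P).
Proof. by []. Qed.

(** * The group law commutes with ring morphisms *)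

Section Naturality.
Variables (R S : comNzRingType) (f : {rmorphism R -> S}) (K : nat).
Variables a1 a2 a3 a4 a6 : R.
Local Notation pt P := (f P.1, f P.2).

Lemma rmorph_unip_inv (u : R) : f (unip_inv K u) = unip_inv K (f u).
Proof.
by rewrite rmorph_sum; apply: eq_bigr => j _; rewrite rmorphXn rmorphB rmorph1.
Qed.

Lemma rmorph_slope_num P Q :
  f (slope_num a1 a2 a4 P Q) = slope_num (f a1) (f a2) (f a4) (pt P) (pt Q).
Proof. by rewrite /slope_num !(rmorphB, rmorphD, rmorphM, rmorphXn). Qed.

Lemma rmorph_slope_den P Q : f (slope_den a1 a2 a3 a4 a6 P Q) =
  slope_den (f a1) (f a2) (f a3) (f a4) (f a6) (pt P) (pt Q).
Proof.
by rewrite /slope_den !(rmorphB, rmorphD, rmorphM, rmorphXn, rmorph1).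
Qed.

Lemma rmorph_third P Q : pt (third K a1 a2 a3 a4 a6 P Q) =
  third K (f a1) (f a2) (f a3) (f a4) (f a6) (pt P) (pt Q).
Proof.
rewrite /third.
set l := slope_num _ _ _ P Q * _; set l' := slope_num _ _ _ _ _ * _.
have fl : f l = l'.
  by rewrite rmorphM rmorph_unip_inv rmorph_slope_num rmorph_slope_den.
rewrite /=; set v := P.2 - _; set v' := f P.2 - _.
have fv : f v = v' by rewrite rmorphB rmorphM fl.
clearbody l l' v v'; rewrite -{}fl -{}fv.
set c2 := _ - a3 * l ^+ 2; set c2' := _ - f a3 * _.
have fc2 : f c2 = c2'.
  by rewrite !(rmorphB, rmorphD, rmorphMn, rmorphM, rmorphXn).
set c3 := _ + a6 * _; set c3' := _ + f a6 * _.
have fc3 : f c3 = c3' by rewrite !(rmorphD, rmorphM, rmorphXn, rmorph1).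
rewrite -{}fc2 -{}fc3 -rmorph_unip_inv.
by clearbody c2 c3; congr pair; rewrite !(rmorphB, rmorphN, rmorphD, rmorphM).
Qed.

Lemma rmorph_opp_pt P :
  pt (opp_pt K a1 a3 P) = opp_pt K (f a1) (f a3) (pt P).
Proof.
by rewrite /opp_pt /= !(rmorphN, rmorphD, rmorphM, rmorph1, rmorph_unip_inv).
Qed.

Lemma rmorph_add_pt P Q : pt (add_pt K a1 a2 a3 a4 a6 P Q) =
  add_pt K (f a1) (f a2) (f a3) (f a4) (f a6) (pt P) (pt Q).
Proof. by rewrite /add_pt rmorph_opp_pt rmorph_third. Qed.

Lemma rmorph_mul_pt n P : pt (mul_pt K a1 a2 a3 a4 a6 n P) =
  mul_pt K (f a1) (f a2) (f a3) (f a4) (f a6) n (pt P).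
Proof.
elim: n => [|n IH]; first by rewrite /= rmorph0.
by rewrite [in LHS]/mul_pt !iterS rmorph_add_pt [X in add_pt _ _ _ _ _ _ _ X]IH.
Qed.

Lemma rmorph_solve_z x : f (solve_z K a1 a2 a3 a4 a6 x) =
  solve_z K (f a1) (f a2) (f a3) (f a4) (f a6) (f x).
Proof.
rewrite /solve_z; elim: K => [|k IH]; first by rewrite /= rmorph0.
by rewrite !iterS -IH /solve_step !(rmorphB, rmorphD, rmorphM, rmorphXn).
Qed.

End Naturality.

(** * Morphisms between truncated polynomial rings *)

Lemma in_qpolyXnE (B : comNzRingType) m (p : {poly B}) :
  in_qpoly 'X^(m.+1) p = take_poly m.+1 p :> {poly B}.
Proof.
rewrite Pdiv.RingMonic.take_poly_rmodp.
exact: (congr1 (Pdiv.CommonRing.rmodp _) (mk_monic_Xn B m.+1)).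
Qed.

Lemma truncP (B : comNzRingType) m (p q : trunc (B := B) m.+1) :
  (forall i, (i < m.+1)%N -> (p : {poly B})`_i = (q : {poly B})`_i) -> p = q.
Proof.
move=> H; apply: val_inj; apply/polyP => i; have [/H//|mi] := ltnP i m.+1.
by rewrite !nth_default // (leq_trans (size_trunc _)).
Qed.

Section TruncMap.
Variables (B C : comNzRingType) (f : {rmorphism B -> C}) (m m' : nat).
Hypothesis le_m'm : (m' <= m)%N.

(** Changing coefficients and lowering the precision in one map lets a single naturality argument
    handle both. *)
Definition trunc_map (p : trunc (B := B) m.+1) : trunc (B := C) m'.+1 :=
  in_qpoly 'X^(m'.+1) (map_poly f (p : {poly B})).

Lemma coef_trunc_map p i : (i < m'.+1)%N ->
  (trunc_map p : {poly C})`_i = f (p : {poly B})`_i.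
Proof. by move=> im; rewrite in_qpolyXnE coef_take_poly im coef_map. Qed.

Lemma trunc_map_zmod_morphism : zmod_morphism trunc_map.
Proof.
move=> p q; apply: truncP => i im.
by rewrite coefB !coef_trunc_map // -rmorphB -coefB.
Qed.

Lemma trunc_map_monoid_morphism : monoid_morphism trunc_map.
Proof.
split=> [|p q]; apply: truncP => i im; rewrite coef_trunc_map //.
  by rewrite !coefC; case: eqP; rewrite ?rmorph1 ?rmorph0.
rewrite !coef_truncM ?(leq_trans im) // !coefM rmorph_sum.
apply: eq_bigr => j _; rewrite rmorphM !coef_trunc_map //.
  by rewrite (leq_ltn_trans _ im) // leq_subr.
by rewrite (leq_trans (ltn_ord j)).
Qed.

Definition trunc_rmorphism : {rmorphism trunc m.+1 -> trunc m'.+1} :=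
  HB.pack trunc_map
    (GRing.isZmodMorphism.Build _ _ trunc_map trunc_map_zmod_morphism)
    (GRing.isMonoidMorphism.Build _ _ trunc_map trunc_map_monoid_morphism).

Lemma trunc_mapC b : trunc_map (truncC m.+1 b) = truncC m'.+1 (f b).
Proof.
apply: truncP => i im; rewrite coef_trunc_map // !coefC.
by case: eqP; rewrite ?rmorph0.
Qed.

Lemma trunc_mapX : trunc_map (truncX m.+1) = truncX m'.+1.
Proof.
apply: truncP => i im; rewrite coef_trunc_map // !in_qpolyXnE !coef_take_poly.
by rewrite im (leq_trans im) // !coefX rmorph_nat.
Qed.

End TruncMap.

(** * Independence of the precision *)

Section Widening.
Variables (B : comNzRingType) (b1 b2 b3 b4 b6 : B).

(** By [solve_zP], m' + 1 rounds of substitution already reach a fixed point. *)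
Lemma solve_z_widen m m' :
  (m' <= m)%N ->
  let c := @truncC B m'.+1 in
  solve_z m.+1 (c b1) (c b2) (c b3) (c b4) (c b6) (truncX m'.+1) =
  solve_z m'.+1 (c b1) (c b2) (c b3) (c b4) (c b6) (truncX m'.+1).
Proof.
move=> le_m c; rewrite [LHS]/solve_z -(subnK (le_m : (m'.+1 <= m.+1)%N)) iterD.
elim: (_ - _)%N => [//|k IH].
by rewrite iterS IH -solve_zP.
Qed.

(** Each denominator is already inverted by the geometric sum of length m' + 1, so [unip_inv_widen]
    applies to all three. *)
Lemma add_pt_widen m m' P Q :
  (m' <= m)%N -> above_O b1 b2 b3 b4 b6 P -> above_O b1 b2 b3 b4 b6 Q ->
  let c := @truncC B m'.+1 in
  add_pt m.+1 (c b1) (c b2) (c b3) (c b4) (c b6) P Q =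
  add_pt m'.+1 (c b1) (c b2) (c b3) (c b4) (c b6) P Q.
Proof.
move=> le_m HP HQ c.
have eq_inv u := @unip_inv_widen _ m.+1 m'.+1 u le_m.
have eq_third : third m.+1 (c b1) (c b2) (c b3) (c b4) (c b6) P Q =
    third m'.+1 (c b1) (c b2) (c b3) (c b4) (c b6) P Q.
  rewrite /third; have := lead_coefV HP HQ; have := slope_denV HP HQ.
  rewrite -/c; set d := slope_den _ _ _ _ _ _ _ => dV.
  rewrite [unip_inv m.+1 d]eq_inv //.
  by set l := slope_num _ _ _ _ _ * _ => cV; rewrite [unip_inv m.+1 _]eq_inv.
rewrite /add_pt eq_third /opp_pt [unip_inv m.+1 _]eq_inv //.
by apply: unip_invP; apply: c0_opp_den; apply: third_above_O.
Qed.

Lemma mul_pt_widen m m' n P :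
  (m' <= m)%N -> above_O b1 b2 b3 b4 b6 P ->
  let c := @truncC B m'.+1 in
  mul_pt m.+1 (c b1) (c b2) (c b3) (c b4) (c b6) n P =
  mul_pt m'.+1 (c b1) (c b2) (c b3) (c b4) (c b6) n P.
Proof.
move=> le_m HP c; elim: n => [//|n IH].
rewrite !mul_ptS IH; apply: (add_pt_widen le_m HP).
exact: (mul_above_O n HP).
Qed.

End Widening.

Section Coefficients.
Variables (B C : comNzRingType) (f : {rmorphism B -> C}).
Variables b1 b2 b3 b4 b6 : B.

Lemma mul_coef_map K K' n i : (i < K')%N -> (K' <= K)%N ->
  f (mul_coef K b1 b2 b3 b4 b6 n i) =
  mul_coef K' (f b1) (f b2) (f b3) (f b4) (f b6) n i.
Proof.
case: K' => // m' im; case: K => // m le_m.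
pose g := @trunc_rmorphism _ _ f m m' le_m.
have gC b : g (truncC m.+1 b) = truncC m'.+1 (f b) by apply: trunc_mapC.
have gX : g (truncX m.+1) = truncX m'.+1 by apply: trunc_mapX.
rewrite /mul_coef -(@coef_trunc_map _ _ f m m' _ _ im).
suff -> : trunc_map f m' (mul_generic m.+1 b1 b2 b3 b4 b6 n).1 =
  (mul_generic m'.+1 (f b1) (f b2) (f b3) (f b4) (f b6) n).1 by [].
(* The morphism [g] lowers the precision of the ring but keeps the length m + 1 of the geometric
   sums, so the target side is first rewritten with that length. *)
rewrite /mul_generic -(mul_pt_widen (m := m)) //; last exact: generic_above_O.
rewrite -!gC; set P := generic_point m.+1 _ _ _ _ _.
have -> : generic_point m'.+1 (f b1) (f b2) (f b3) (f b4) (f b6) =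
    (g P.1, g P.2).
  rewrite /P /generic_point; congr pair; first exact: esym gX.
  rewrite -(@solve_z_widen _ _ _ _ _ _ m m' le_m) -!gC -gX.
  exact: esym (rmorph_solve_z g _ _ _ _ _ _ _).
have H := congr1 fst (rmorph_mul_pt g m.+1 (truncC _ b1) (truncC _ b2)
  (truncC _ b3) (truncC _ b4) (truncC _ b6) n P).
exact H.
Qed.

End Coefficients.

(** * Polynomial sequences and finite differences *)

Section PolynomialSequences.
Variable B : comAlgType rat.

Definition polyfun (d : nat) (s : nat -> B) : Prop :=
  exists2 p : {poly B}, (size p <= d.+1)%N & forall n, s n = p.[n%:R].

Lemma eq_polyfun d s t : s =1 t -> polyfun d s -> polyfun d t.
Proof. by move=> st [p szp sp]; exists p => // n; rewrite -st. Qed.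

Lemma polyfunC d c : polyfun d (fun=> c).
Proof.
exists c%:P => [|n]; last by rewrite hornerC.
by rewrite (leq_trans (size_polyC_leq1 _)).
Qed.

Lemma polyfunD d s t :
  polyfun d s -> polyfun d t -> polyfun d (fun n => s n + t n).
Proof.
move=> [p szp sp] [q szq tq]; exists (p + q) => [|n].
  by rewrite (leq_trans (size_polyD _ _)) // geq_max szp.
by rewrite hornerD sp tq.
Qed.

Lemma polyfunM d e s t :
  polyfun d s -> polyfun e t -> polyfun (d + e) (fun n => s n * t n).
Proof.
move=> [p szp sp] [q szq tq]; exists (p * q) => [|n];
  last by rewrite hornerM sp tq.
rewrite (leq_trans (size_polyMleq _ _)) // -subn1 leq_subLR.
by rewrite (leq_trans (leq_add szp szq)) // addnS addSn.
Qed.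

Lemma polyfun_sum d (I : Type) (r : seq I) (s : I -> nat -> B) :
  (forall i, polyfun d (s i)) -> polyfun d (fun n => \sum_(i <- r) s i n).
Proof.
move=> Hs; elim: r => [|i r IH].
  by apply: eq_polyfun (polyfunC d 0) => n; rewrite big_nil.
by apply: eq_polyfun (polyfunD (Hs i) IH) => n; rewrite big_cons.
Qed.

Definition antidifference (p q : {poly B}) : Prop :=
  forall x, q.[x + 1] - q.[x] = p.[x].

Lemma antidifference_sum (d : nat) (c : nat -> B) (p : nat -> {poly B}) k :
  (forall j, (j < k)%N ->
    exists2 q : {poly B}, (size q <= d)%N & antidifference (p j) q) ->
  exists2 q : {poly B}, (size q <= d)%N &
    antidifference (\sum_(j < k) c j *: p j) q.
Proof.
elim: k => [_|k IH Hp].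
  by exists 0 => [|x]; rewrite ?size_poly0 // big_ord0 !horner0 subrr.
have [j jk|q szq Hq] := IH; first by apply: Hp; rewrite ltnW.
have [r szr Hr] := Hp k (leqnn _).
exists (q + c k *: r) => [|x].
  rewrite (leq_trans (size_polyD _ _)) // geq_max szq.
  by rewrite (leq_trans (size_scale_leq _ _)).
rewrite big_ord_recr /= !hornerD !hornerZ -Hq -Hr; ring.
Qed.

(* (x+1)^(d+1) - x^(d+1) is (d+1) x^d plus terms of lower degree. *)
Lemma antidifferenceXn d :
  exists2 q : {poly B}, (size q <= d.+2)%N & antidifference 'X^d q.
Proof.
have [k] := ubnP d; elim: k d => // k IH d le_dk.
have [j jd|q szq Hq] := @antidifference_sum d.+2 (fun j => 'C(d.+1, j)%:R)
    (fun j => 'X^j) d.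
  have [|q szq Hq] := IH j; first exact: leq_trans jd _.
  by exists q => //; apply: leq_trans szq _; rewrite !ltnS ltnW.
exists ((d.+1%:R^-1 : rat)%:A *: ('X^(d.+1) - q)) => [|x].
  rewrite (leq_trans (size_scale_leq _ _)) // (leq_trans (size_polyD _ _)) //.
  by rewrite size_polyN geq_max szq size_polyXn leqnn.
rewrite !hornerZ -mulrBr !hornerD !hornerN !hornerXn.
have E : (x + 1) ^+ d.+1 - x ^+ d.+1 = (\sum_(j < d) 'C(d.+1, j)%:R *: 'X^j).[x]
    + d.+1%:R * x ^+ d.
  rewrite [x + 1]addrC exprDn big_ord_recr /= subnn expr0 mul1r binn mulr1n.
  rewrite addrK big_ord_recr /= expr1n mul1r binSn mulr_natl; congr (_ + _).
  rewrite horner_sum; apply: eq_bigr => j _.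
  by rewrite expr1n mul1r hornerZ hornerXn mulr_natl.
rewrite (_ : _ - _ = d.+1%:R * x ^+ d).
  have -> : d.+1%:R = (d.+1%:R : rat)%:A :> B by rewrite scaler_nat.
  rewrite mulrA mulr_algl scalerA mulVf ?Num.Theory.pnatr_eq0 //.
  by rewrite scale1r mul1r.
transitivity ((x + 1) ^+ d.+1 - x ^+ d.+1 - (q.[x + 1] - q.[x])); first by ring.
by rewrite Hq E addrC addKr.
Qed.

Lemma polyfun_antidifference d (s : nat -> B) :
  polyfun d (fun n => s n.+1 - s n) -> polyfun d.+1 s.
Proof.
move=> [p szp sp].
have [j jp|q szq Hq] := @antidifference_sum d.+2 (fun j => p`_j)
    (fun j => 'X^j) (size p).
  have [q szq Hq] := antidifferenceXn j.
  by exists q => //; apply: leq_trans szq _; rewrite ltnS (leq_trans jp).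
have {}Hq x : q.[x + 1] - q.[x] = p.[x].
  by rewrite Hq -poly_def coefK.
(* The constant adjusts the value at 0; equal differences then propagate the agreement to all n. *)
exists (q + (s 0 - q.[0])%:P) => [|n].
  rewrite (leq_trans (size_polyD _ _)) // geq_max szq.
  by rewrite (leq_trans (size_polyC_leq1 _)).
rewrite hornerD hornerC; elim: n => [|n IH]; first by rewrite addrC subrK.
rewrite -[LHS](subrK (s n)) sp IH -Hq -natr1; ring.
Qed.

End PolynomialSequences.

(** * Graded sequences of truncated series, and congruence modulo X *)

Section Filtration.
Variables (B : comAlgType rat) (m : nat).
Local Notation A := (trunc (B := B) m.+1).
Local Notation X := (truncX m.+1 : A).
Local Notation inv := (unip_inv m.+1).
Implicit Types s t r : nat -> A.

(** Only the coefficients below [k] are constrained, so that [k] can be the induction variable of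
    the bootstrap. *)
Definition filtered (k : nat) (s : nat -> A) : Prop :=
  forall i, (i < k)%N -> polyfun i (fun n => (s n : {poly B})`_i).

Lemma eq_filtered k s t : s =1 t -> filtered k s -> filtered k t.
Proof. by move=> st Hs i ik; apply: eq_polyfun (Hs i ik) => n; rewrite st. Qed.


Lemma filteredC k (a : A) : filtered k (fun=> a).
Proof. by move=> i _; apply: polyfunC. Qed.

Lemma filteredD k s t :
  filtered k s -> filtered k t -> filtered k (fun n => s n + t n).
Proof.
move=> Hs Ht i ik; apply: eq_polyfun (polyfunD (Hs i ik) (Ht i ik)) => n.
by rewrite coefD.
Qed.

(** In the convolution for X^i, the degree bounds j and i - j add up to i. *)
Lemma filteredM k s t :
  filtered k s -> filtered k t -> filtered k (fun n => s n * t n).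
Proof.
move=> Hs Ht i ik; have [im|mi] := ltnP i m.+1; last first.
  apply: eq_polyfun (polyfunC i 0) => n.
  by rewrite nth_default // (leq_trans (size_trunc _)).
have : polyfun i (fun n => \sum_(j <- enum 'I_i.+1)
    (s n : {poly B})`_j * (t n : {poly B})`_(i - j)).
  apply: (@polyfun_sum _ i _ _ (fun (j : 'I_i.+1) n => _)) => j.
  have ji : (j <= i)%N by rewrite -ltnS.
  rewrite -{1}(subnKC ji); apply: polyfunM; [apply: Hs | apply: Ht].
    exact: leq_ltn_trans ik.
  by apply: leq_ltn_trans ik; rewrite leq_subr.
by apply: eq_polyfun => n; rewrite coef_truncM // coefM big_enum.
Qed.

Lemma filteredN k s : filtered k s -> filtered k (fun n => - s n).
Proof.
move=> Hs; apply: eq_filtered (filteredM (filteredC (-1 : A)) Hs) => n.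
by rewrite mulN1r.
Qed.

Lemma filteredXn k s j : filtered k s -> filtered k (fun n => s n ^+ j).
Proof.
move=> Hs; elim: j => [|j IH]; first exact: filteredC.
by apply: eq_filtered (filteredM Hs IH) => n; rewrite exprS.
Qed.

Lemma filtered_unip_inv k s : filtered k s -> filtered k (fun n => inv (s n)).
Proof.
move=> Hs.
suff H j : filtered k (fun n => \sum_(i < j) (1 - s n) ^+ i) by exact: H.
elim: j => [|j IH].
  by apply: eq_filtered (filteredC (0 : A)) => n; rewrite big_ord0.
have H1s := filteredD (filteredC (1 : A)) (filteredN Hs).
apply: eq_filtered (filteredD IH (filteredXn j H1s)) => n.
by rewrite big_ord_recr.
Qed.

Lemma coef_truncXM (p : A) i : (X * p : {poly B})`_i =
  if (0 < i < m.+1)%N then (p : {poly B})`_i.-1 else 0.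
Proof.
have [im|mi] := ltnP i m.+1; last first.
  by rewrite andbF nth_default // (leq_trans (size_trunc _)).
rewrite andbT; transitivity (('X * (p : {poly B}))`_i).
  have -> : X * p = in_qpoly 'X^(m.+1) ('X * (p : {poly B})).
    rewrite in_qpolyM; congr (_ * _); apply: truncP => j jm.
    by rewrite in_qpolyXnE coef_take_poly jm.
  by rewrite in_qpolyXnE coef_take_poly im.
by rewrite coefXM; case: i im.
Qed.

(** X is a zero divisor in the truncated ring, so divisibility of the difference does not determine
    a quotient; a graded one is therefore part of the relation. *)
Definition congX (k : nat) (s t : nat -> A) : Prop :=
  [/\ filtered k s, filtered k t &
      exists2 r, filtered k r & forall n, s n = t n + X * r n].

Lemma congX_refl k s : filtered k s -> congX k s s.
Proof.
move=> Hs; split=> //; exists (fun=> 0) => [|n]; first exact: filteredC.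
by rewrite mulr0 addr0.
Qed.

Lemma congXC k a : congX k (fun=> a) (fun=> a).
Proof. exact/congX_refl/filteredC. Qed.

Lemma congXD k s s' t t' :
  congX k s s' -> congX k t t' ->
  congX k (fun n => s n + t n) (fun n => s' n + t' n).
Proof.
move=> [Hs Hs' [r Hr rE]] [Ht Ht' [q Hq qE]]; split; [exact: filteredD..|].
exists (fun n => r n + q n) => [|n]; first exact: filteredD.
by rewrite rE qE; ring.
Qed.

Lemma congXM k s s' t t' :
  congX k s s' -> congX k t t' ->
  congX k (fun n => s n * t n) (fun n => s' n * t' n).
Proof.
move=> [Hs Hs' [r Hr rE]] [Ht Ht' [q Hq qE]]; split; [exact: filteredM..|].
exists (fun n => r n * t n + s' n * q n) => [|n]; last by rewrite rE qE; ring.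
by apply: filteredD; apply: filteredM.
Qed.

Lemma congXN k s s' :
  congX k s s' -> congX k (fun n => - s n) (fun n => - s' n).
Proof.
move=> [Hs Hs' [r Hr rE]]; split; [exact: filteredN..|].
by exists (fun n => - r n) => [|n]; [exact: filteredN | rewrite rE; ring].
Qed.

Lemma congXXn k s s' j :
  congX k s s' -> congX k (fun n => s n ^+ j) (fun n => s' n ^+ j).
Proof.
move=> Hs; elim: j => [|j IH]; first exact: congXC.
have [H1 H2 [r Hr rE]] := congXM Hs IH.
split; [by apply: eq_filtered H1 => n; rewrite exprS
       | by apply: eq_filtered H2 => n; rewrite exprS |].
exists r => [|n]; first exact: Hr.
by rewrite [LHS]exprS [s' n ^+ j.+1]exprS rE.
Qed.

Lemma congXMn k s s' j :
  congX k s s' -> congX k (fun n => s n *+ j) (fun n => s' n *+ j).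
Proof.
move=> Hs; have [H1 H2 [r Hr rE]] := congXM (congXC k (j%:R : A)) Hs.
split; [by apply: eq_filtered H1 => n; rewrite mulr_natl
       | by apply: eq_filtered H2 => n; rewrite mulr_natl |].
exists r => [|n]; first exact: Hr.
by rewrite -(mulr_natl (s n)) -(mulr_natl (s' n)) rE.
Qed.

(** The quotient comes from 1/s - 1/s' = - (s - s') / (s s'). *)
Lemma congX_unip_inv k s s' :
  (forall n, s n * inv (s n) = 1) -> (forall n, s' n * inv (s' n) = 1) ->
  congX k s s' -> congX k (fun n => inv (s n)) (fun n => inv (s' n)).
Proof.
move=> sV s'V [Hs Hs' [r Hr rE]]; split; [exact: filtered_unip_inv..|].
exists (fun n => - (r n * inv (s n) * inv (s' n))) => [|n].
  apply: filteredN; apply: filteredM; last exact: filtered_unip_inv.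
  by apply: filteredM => //; exact: filtered_unip_inv.
have XrE : X * r n = s n - s' n by rewrite rE addrC addKr.
rewrite mulrN !mulrA XrE.
transitivity (inv (s' n) - (s n * inv (s n)) * inv (s' n) +
  (s' n * inv (s' n)) * inv (s n)); last by ring.
by rewrite sV s'V !mul1r subrr add0r.
Qed.

End Filtration.

(** * The group law modulo X and the degree bound *)

Section GroupLaw.
Variables (B : comAlgType rat) (m : nat) (b1 b2 b3 b4 b6 : B).
Local Notation A := (trunc (B := B) m.+1).
Local Notation a1 := (truncC m.+1 b1).
Local Notation a2 := (truncC m.+1 b2).
Local Notation a3 := (truncC m.+1 b3).
Local Notation a4 := (truncC m.+1 b4).
Local Notation a6 := (truncC m.+1 b6).
Local Notation onO := (@above_O B m.+1 b1 b2 b3 b4 b6).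
Local Notation add := (add_pt m.+1 a1 a2 a3 a4 a6).
Local Notation X := (truncX m.+1 : A).
Implicit Types P Q : nat -> A * A.

Definition congX_pt k P Q :=
  congX k (fun n => (P n).1) (fun n => (Q n).1) /\
  congX k (fun n => (P n).2) (fun n => (Q n).2).

(** This descends through polynomial expressions only; congruences of inverses must be among the
    hypotheses. *)
Ltac congX_ring := repeat first [exact: congXC | assumption | apply: congXD
  | apply: congXN | apply: congXM | apply: congXXn | apply: congXMn].

Lemma congX_opp_pt k P P' : (forall n, onO (P n)) -> (forall n, onO (P' n)) ->
  congX_pt k P P' ->
  congX_pt k (fun n => opp_pt m.+1 a1 a3 (P n))
    (fun n => opp_pt m.+1 a1 a3 (P' n)).
Proof.
move=> OP OP' [H1 H2].
have Hu : congX k (fun n => unip_inv m.+1 (1 + a1 * (P n).1 + a3 * (P n).2))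
    (fun n => unip_inv m.+1 (1 + a1 * (P' n).1 + a3 * (P' n).2)).
  apply: congX_unip_inv; [by move=> n; apply: unip_invP (c0_opp_den (OP n))
    | by move=> n; apply: unip_invP (c0_opp_den (OP' n)) | congX_ring].
by split; rewrite /opp_pt /=; congX_ring.
Qed.

Lemma congX_third k P P' Q Q' :
  (forall n, onO (P n)) -> (forall n, onO (P' n)) ->
  (forall n, onO (Q n)) -> (forall n, onO (Q' n)) ->
  congX_pt k P P' -> congX_pt k Q Q' ->
  congX_pt k (fun n => third m.+1 a1 a2 a3 a4 a6 (P n) (Q n))
    (fun n => third m.+1 a1 a2 a3 a4 a6 (P' n) (Q' n)).
Proof.
move=> OP OP' OQ OQ' [P1 P2] [Q1 Q2].
pose l P Q (n : nat) := slope_num a1 a2 a4 (P n) (Q n)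
  * unip_inv m.+1 (slope_den a1 a2 a3 a4 a6 (P n) (Q n)).
pose c3 P Q n := 1 + a2 * l P Q n + a4 * l P Q n ^+ 2 + a6 * l P Q n ^+ 3.
have Hd : congX k
    (fun n => unip_inv m.+1 (slope_den a1 a2 a3 a4 a6 (P n) (Q n)))
    (fun n => unip_inv m.+1 (slope_den a1 a2 a3 a4 a6 (P' n) (Q' n))).
  apply: congX_unip_inv; [by move=> n; apply: slope_denV (OP n) (OQ n)
    | by move=> n; apply: slope_denV (OP' n) (OQ' n) |].
  by rewrite /slope_den; congX_ring.
have Hn : congX k (fun n => slope_num a1 a2 a4 (P n) (Q n))
    (fun n => slope_num a1 a2 a4 (P' n) (Q' n)).
  by rewrite /slope_num; congX_ring.
have Hl : congX k (fun n => l P Q n) (fun n => l P' Q' n) by exact: congXM.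
have Hc : congX k (fun n => unip_inv m.+1 (c3 P Q n))
    (fun n => unip_inv m.+1 (c3 P' Q' n)).
  apply: congX_unip_inv; [by move=> n; apply: lead_coefV (OP n) (OQ n)
    | by move=> n; apply: lead_coefV (OP' n) (OQ' n) |].
  by rewrite /c3; congX_ring.
(* Naming the slope and the leading coefficient allows them to be generalized, so that [congX_ring]
   treats them as atoms. *)
rewrite /third; change (congX_pt k
  (fun n => let l' := l P Q n in let v := (P n).2 - l' * (P n).1 in
    let x := - ((a2 * v + a4 * l' * v *+ 2 + a6 * l' ^+ 2 * v *+ 3
              - a1 * l' - a3 * l' ^+ 2) * unip_inv m.+1 (c3 P Q n))
             - (P n).1 - (Q n).1 in
    (x, l' * x + v))
  (fun n => let l' := l P' Q' n in let v := (P' n).2 - l' * (P' n).1 in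
    let x := - ((a2 * v + a4 * l' * v *+ 2 + a6 * l' ^+ 2 * v *+ 3
              - a1 * l' - a3 * l' ^+ 2) * unip_inv m.+1 (c3 P' Q' n))
             - (P' n).1 - (Q' n).1 in
    (x, l' * x + v))).
move: Hl Hc; move: (l P Q) (l P' Q') (c3 P Q) (c3 P' Q') => l1 l2 u1 u2 Hl Hc.
by split => /=; congX_ring.
Qed.

Lemma opp_ptK (R : A * A) : onO R ->
  opp_pt m.+1 a1 a3 (opp_pt m.+1 a1 a3 R) = R.
Proof.
move=> HR; have := unip_invP (c0_opp_den (opp_above_O HR)).
have := unip_invP (c0_opp_den HR).
rewrite {2 3 4 5}/opp_pt /=; set u := unip_inv m.+1 (1 + a1 * R.1 + _) => uV.
set d := 1 + a1 * - _ + _; set u' := unip_inv m.+1 d.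
(* Since u (1 + a1 x + a3 z) = 1, the denominator of the second negation is u itself. *)
have -> : d = u by rewrite /d -{1}uV; ring.
move=> uu'; rewrite !mulNr !opprK -!mulrA uu' !mulr1.
by case: (R).
Qed.

(** R, -R and O are collinear, so the third point on the line through O and R is -R, and negating it
    returns R. *)
Lemma add_O_pt (R : A * A) : onO R -> add (0, 0) R = R.
Proof.
move=> HR; have O_O := O_above_O m b1 b2 b3 b4 b6.
rewrite /add_pt -[RHS](opp_ptK HR); congr opp_pt; apply/esym.
apply: collinear_unique => //.
have [l [v [c [H1 H2 H3 H4]]]] := opp_collinear HR.
exists l, v, c; split; [exact: H3 | exact: H1 | exact: H2 |].
by rewrite H4 -[in RHS]mulrA [_ * ('X - _)]mulrC.
Qed.

Lemma congX_add_pt k (R : A * A) Q r : onO R -> (forall n, onO (Q n)) ->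
  R.1 = X -> R.2 = X * r ->
  filtered k (fun n => (Q n).1) -> filtered k (fun n => (Q n).2) ->
  congX_pt k (fun n => add R (Q n)) Q.
Proof.
move=> HR HQ R1 R2 Q1 Q2.
have O_O := O_above_O m b1 b2 b3 b4 b6.
have HRO : congX_pt k (fun=> R) (fun=> (0, 0)).
  split; (split; [exact: filteredC..|]).
    by exists (fun=> 1) => [|_]; [exact: filteredC | rewrite R1 add0r mulr1].
  by exists (fun=> r) => [|_]; [exact: filteredC | rewrite R2 add0r].
have HQQ : congX_pt k Q Q by split; apply: congX_refl.
have [[H1 H1' [r1 Hr1 E1]] [H2 H2' [r2 Hr2 E2]]] :
    congX_pt k (fun n => add R (Q n)) (fun n => add (0, 0) (Q n)).
  apply: congX_opp_pt; [by move=> n; apply: third_above_O..|].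
  exact: (congX_third (P := fun=> R) (P' := fun=> (0, 0))).
split; split=> //.
  by exists r1 => // n; rewrite E1 add_O_pt.
by exists r2 => // n; rewrite E2 add_O_pt.
Qed.

(** The coefficient of X^(i+1) in s(n+1) - s(n) is the coefficient of X^i in the quotient, of degree
    at most i in n; summation gives degree at most i + 1. This gains one order, and the vanishing
    constant terms start it. *)
Lemma filtered_step k (s s' : nat -> A) : (forall n, c0 (s n) = 0) ->
  s' =1 (fun n => s n.+1) -> congX k s' s -> filtered k.+1 s.
Proof.
move=> s0 s'E [_ _ [r Hr rE]] [_|i].
  by apply: eq_polyfun (polyfunC 0 0) => n; rewrite [RHS]s0.
rewrite ltnS => ik; apply: polyfun_antidifference.
have [im|mi] := ltnP i.+1 m.+1.
  apply: eq_polyfun (Hr i ik) => n.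
  by rewrite -coefB -s'E rE addrC addKr coef_truncXM /= im.
apply: eq_polyfun (polyfunC i 0) => n.
by rewrite !nth_default ?subrr // (leq_trans (size_trunc _)).
Qed.

Lemma filtered_mul_generic k :
  filtered k (fun n => (mul_generic m.+1 b1 b2 b3 b4 b6 n).1) /\
  filtered k (fun n => (mul_generic m.+1 b1 b2 b3 b4 b6 n).2).
Proof.
have HR := generic_above_O m b1 b2 b3 b4 b6.
have HQ n : onO (mul_generic m.+1 b1 b2 b3 b4 b6 n) by apply: mul_above_O.
have [G GE] := solve_z_X3 m b1 b2 b3 b4 b6.
elim: k => [|k [H1 H2]]; first by split=> [] [].
(* The z-coordinate of P is F = X^3 G, hence the quotient X^2 G. *)
have [|C1 C2] := congX_add_pt HR HQ (erefl _) _ H1 H2 (r := X ^+ 2 * G).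
  by apply: etrans GE _; rewrite [in RHS]mulrA -exprS.
split; [apply: filtered_step C1 | apply: filtered_step C2] => // n.
  by have [] := above_OE (HQ n).
by have [] := above_OE (HQ n).
Qed.

End GroupLaw.

(** * The nodal cubic z + x z = x^3 *)

Lemma collinear_nodal (R : comNzRingType) (P Q S : R * R) :
  collinear 1 0 0 0 0 P Q S -> (1 + P.1) * (1 + Q.1) * (1 + S.1) = 1.
Proof.
move=> [l [v [c [_ _ _]]]]; rewrite weierstrass_line !mul0r.
rewrite !(mul0rn, addr0, add0r, subr0, mul1r, sub0r) => E.
(* On a line the equation reads x^3 - (1 + x)(l x + v) = c (x - x1)(x - x2)(x - x3). The leading
   coefficient gives c = 1, and the node's value x = -1 eliminates l and v. *)
have c1 : 1 = c.
  move/(congr1 (fun p : {poly R} => p`_3)): E; rewrite -cubic_roots.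
  by rewrite !(coefD, coefN, coefCM, coefXn, coefX, coefC) /=
    !(mulr0, mulr1, addr0, add0r).
move/(congr1 (fun p : {poly R} => p.[-1])): E; rewrite -c1.
rewrite !(hornerD, hornerN, hornerM, hornerXn, hornerX, hornerC) => E.
transitivity (- (1 * ((- 1 - P.1) * (- 1 - Q.1) * (- 1 - S.1)))); first by ring.
by rewrite -E; ring.
Qed.

Section Nodal.
Variables (B : comNzRingType) (m : nat).
Local Notation onO := (@above_O B m.+1 1 0 0 0 0).
Local Notation add := (add_pt m.+1 (truncC m.+1 (1 : B)) (truncC m.+1 0)
  (truncC m.+1 0) (truncC m.+1 0) (truncC m.+1 0)).

Lemma truncC0 : truncC m.+1 (0 : B) = 0.
Proof. exact: rmorph0. Qed.

Lemma truncC1 : truncC m.+1 (1 : B) = 1.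
Proof. by []. Qed.

(** For the third point S, 1 + x(-S) = 1 - x(S) / (1 + x(S)) = 1 / (1 + x(S)), and [collinear_nodal]
    evaluates this inverse. *)
Lemma add_nodal P Q : onO P -> onO Q ->
  1 + (add P Q).1 = (1 + P.1) * (1 + Q.1).
Proof.
move=> HP HQ; have := third_collinear HP HQ.
have := c0_opp_den (third_above_O HP HQ); rewrite /add_pt.
rewrite truncC0 truncC1; move: (third _ _ _ _ _ _ _ _) => S.
rewrite /opp_pt /= mul0r addr0 mul1r => /unip_invP uV /collinear_nodal E.
set u := unip_inv _ _ in uV *.
change (1 - S.1 * u = (1 + P.1) * (1 + Q.1)).
transitivity ((1 + P.1) * (1 + Q.1) * ((1 + S.1) * u));
  last by rewrite uV mulr1.
rewrite mulrA E mul1r -[in LHS]uV; ring.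
Qed.

(** Iterating [add_nodal] gives 1 + x(nP) = (1 + X)^n. *)
Lemma mul_coef_nodal n i : (0 < i <= m)%N ->
  mul_coef m.+1 (1 : B) 0 0 0 0 n i = 'C(n, i)%:R.
Proof.
move=> /andP[i0 im].
have HR := generic_above_O m (1 : B) 0 0 0 0.
have H : 1 + (mul_generic m.+1 (1 : B) 0 0 0 0 n).1
    = in_qpoly 'X^(m.+1) ((1 + 'X) ^+ n).
  rewrite rmorphXn rmorphD rmorph1 -/(truncX m.+1).
  elim: n => [|n IH]; first by rewrite addr0.
  by rewrite exprS -IH /mul_generic mul_ptS add_nodal //; apply: mul_above_O.
have := congr1 (fun p : trunc m.+1 => (p : {poly B})`_i) H.
rewrite coefD coefC gtn_eqF // add0r in_qpolyXnE coef_take_poly ltnS im.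
move=> H'; rewrite [LHS]H' exprDn coef_sum.
have E j : (1 ^+ (n - j) * 'X^j *+ 'C(n, j) : {poly B})`_i =
    (i == j)%:R *+ 'C(n, j).
  by rewrite expr1n mul1r coefMn coefXn.
under eq_bigr do rewrite E.
have [ni|ni] := ltnP n i.
  rewrite bin_small // big1 // => j _.
  by rewrite gtn_eqF ?mul0rn // (leq_ltn_trans _ ni) // -ltnS.
rewrite (bigD1 (Ordinal (ni : (i < n.+1)%N))) //= eqxx big1 ?addr0 // => j.
by rewrite -val_eqE eq_sym => /negPf /= ->; rewrite mul0rn.
Qed.

End Nodal.

(** * Exact degree and conclusion *)

Lemma size_binomial_poly (F : numDomainType) (p : {poly F}) (i : nat) :
  (forall n : nat, p.[n%:R] = 'C(n, i)%:R) -> (i < size p)%N.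
Proof.
move=> Hp; rewrite ltnNge; apply/negP => szp.
(* The i distinct roots 0, ..., i - 1 would force p = 0, against the value 1 at i. *)
have p0 : p = 0.
  apply: (@roots_geq_poly_eq0 _ p [seq n%:R | n <- iota 0 i]).
  - apply/allP => _ /mapP[n + ->]; rewrite mem_iota => /andP[_ ni].
    by rewrite rootE Hp bin_small.
  - rewrite map_inj_uniq ?iota_uniq // => a b /eqP.
    by rewrite Num.Theory.eqr_nat => /eqP.
  - by rewrite size_map size_iota.
by move/eqP: (Hp i); rewrite p0 horner0 binn eq_sym oner_eq0.
Qed.

Unset Implicit Arguments.
Set Strict Implicit.

Theorem mainTheorem1 (i : nat) (hi : (1 <= i)%N) :
  exists Psi : {poly {mpoly rat[5]}},
    [/\ size Psi = i.+1,
        exists Phi : {poly {mpoly rat[5]}}, Psi = 'X * Phi &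
        forall K n : nat, (2 <= K)%N -> (i < K)%N ->
          map_mpoly (intr : int -> rat) (multiplication_polynomial K i n)
          = Psi.[n%:R]].
Proof.
pose x k : {mpoly rat[5]} := 'X_(inord k).
have [filt _] := filtered_mul_generic i (x 0%N) (x 1%N) (x 2) (x 3) (x 4) i.+1.
have {filt}[Psi szPsi PsiE] := filt i (leqnn _).
have {}PsiE n :
    mul_coef i.+1 (x 0%N) (x 1%N) (x 2) (x 3) (x 4) n i = Psi.[n%:R].
  by rewrite -PsiE.
exists Psi; split.
- apply/eqP; rewrite eqn_leq szPsi /=.
  (* Evaluation at a1 = 1 and all other coefficients 0, the nodal cubic; specializing coefficients
     cannot increase the size. *)
  pose v (k : 'I_5) : rat := (k == inord 0)%:R.
  apply: (@leq_trans (size (map_poly (meval v) Psi))); last exact: size_poly.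
  apply: size_binomial_poly => n.
  have -> : n%:R = (n%:R : {mpoly rat[5]}).@[v] :> rat by rewrite rmorph_nat.
  rewrite horner_map -PsiE /= (@mul_coef_map _ _ (meval v) _ _ _ _ _ _ i.+1) //.
  have vE k : (k < 5)%N -> (x k).@[v] = (k == 0%N)%:R.
    by move=> k5; rewrite mevalXU /v -val_eqE /= !inordK.
  by rewrite /= !vE //= mul_coef_nodal ?hi ?leqnn.
- have : root Psi 0.
    (* The value at n = 0 is a coefficient of the x-coordinate of O, which is zero. *)
    rewrite rootE -[0]/(0%:R) -PsiE; apply/eqP; exact: coef0.
  move=> /factor_theorem[q PsiX]; exists q.
  by apply: etrans PsiX _; rewrite subr0 mulrC.
move=> K n _ iK; rewrite /multiplication_polynomial.
(* One application extends scalars to the rationals and lowers K to i + 1, the precision at which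
   [Psi] was obtained. *)
rewrite (@mul_coef_map _ _ (map_mpoly (intr : int -> rat)) _ _ _ _ _ _ i.+1) //.
have xE k : x k = map_mpoly (intr : int -> rat) 'X_(inord k).
  exact: esym (map_mpolyX _ _).
rewrite -PsiE !xE.
reflexivity.
Qed.
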